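(* Let $G$ be a finite $2$-generated nilpotent group. (i) We have $\gamma_t(\Delta(G)) = 1$ if and only if $G$ is cyclic. (ii) Assume that $G$ has exactly $s \geq 1$ noncyclic Sylow subgroups and let $p$ be the smallest prime such that the Sylow $p$-subgroup of $G$ is not cyclic. Then $\gamma_t(\Delta(G)) \geq s+1$, with equality if $p \geq s$.
   Context: A group is $2$-generated if it can be generated by two elements (cyclic groups are included). The generating graph $\Gamma(G)$ of a finite group $G$ is the graph whose vertices are the elements of $G$ and where $g,h \in G$ are adjacent if $G = \langle g,h\rangle$ (loops are not included when $G$ is cyclic). $\Delta(G)$ is the graph obtained from $\Gamma(G)$ by removing its isolated vertices. The total domination number $\gamma_t(\Gamma)$ of a finite graph $\Gamma$ is the least size of a set $S$ of vertices of $\Gamma$ such that every vertex of $\Gamma$ is adjacent to a vertex in $S$.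
   Formalization: When G is cyclic, loops are included in the generating graph (each generator is adjacent to itself), contrary to the stated convention; without loops part (i) fails, e.g. the cyclic group of order 2 would have total domination number 2. *)

(* Defs.v *)
From HB Require Import structures.
From mathcomp Require Import all_boot all_fingroup all_solvable.

Set Implicit Arguments.
Unset Strict Implicit.
Unset Printing Implicit Defensive.

Local Open Scope group_scope.

(* A finite graph is a vertex set V : {set T} with an adjacency relation      *)
(* e : rel T, which is only used between elements of V.                       *)
Section Graphs.

Variables (T : finType) (e : rel T).

Definition nonisolated (V : {set T}) : {set T} :=
  [set x in V | [exists y in V, e x y]].

Definition total_dominating (V S : {set T}) : bool :=
  (S \subset V) && [forall x in V, exists y in S, e x y].

(* Total dominating sets exist exactly when V itself is one, that is, when    *)
(* the graph has no isolated vertex; otherwise the value is the junk #|V|.    *)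
Definition total_domination_number (V : {set T}) : nat :=
  #|[arg min_(S < V | total_dominating V S) #|S|]|.

Lemma total_domination_numberP (V : {set T}) :
    (forall x, x \in V -> exists2 y, y \in V & e x y) ->
  (exists2 S, total_dominating V S & total_domination_number V = #|S|)
    /\ (forall S, total_dominating V S -> total_domination_number V <= #|S|).
Proof.
move=> noisoV; have domV : total_dominating V V.
  rewrite /total_dominating subxx; apply/forall_inP => x /noisoV[y Vy exy].
  by apply/exists_inP; exists y.
by rewrite /total_domination_number; case: arg_minnP => // S domS minS; split;
  [exists S | apply: minS].
Qed.

End Graphs.

Section GeneratingGraph.

Variable gT : finGroupType.
Implicit Type G : {group gT}.

Definition two_generated G : Prop :=
  exists x y : gT, G :=: <<[set x; y]>>.

(* The case x = y is allowed: a generator of a cyclic group is adjacent to    *)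
(* itself. Without these loops no nonempty graph would have total domination  *)
(* number 1. There are no loops when G is not cyclic (gen_adj_neq).           *)
Definition gen_adj G : rel gT := [rel x y | <<[set x; y]>> == G :> {set gT}].

Lemma gen_adj_neq G x y : ~~ cyclic G -> gen_adj G x y -> x != y.
Proof.
move=> ncG /eqP defG; apply: contraNneq ncG => eq_xy.
by rewrite -defG eq_xy setUid; apply: cycle_cyclic.
Qed.

Definition Delta_vertices G : {set gT} := nonisolated (gen_adj G) G.

Lemma Delta_nonisolated G x : x \in Delta_vertices G ->
  exists2 y, y \in Delta_vertices G & gen_adj G x y.
Proof.
rewrite inE => /andP[Gx /exists_inP[y Gy xy]]; exists y => //.
rewrite inE Gy; apply/exists_inP; exists x => //.
by rewrite /gen_adj /= setUC.
Qed.

Definition gamma_t_Delta G : nat :=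
  total_domination_number (gen_adj G) (Delta_vertices G).

Definition noncyclic_Sylows G : {set {group gT}} :=
  [set P : {group gT} | Sylow G P & ~~ cyclic P].

Definition noncyclic_Sylow_prime G (q : nat) : Prop :=
  prime q /\ exists2 P : {group gT}, q.-Sylow(G) P & ~~ cyclic P.

End GeneratingGraph.

(* Main.v *)
Require Import Defs.
From mathcomp Require Import all_boot all_fingroup all_solvable.

(** A finite nilpotent group is the direct product of its Sylow subgroups
    'O_q(G), and everything here is decided one Sylow subgroup at a time: x and
    y generate G exactly when x.`_q and y.`_q generate 'O_q(G) for each prime q
    dividing #|G| (gen_adj_local), and the q-components of an element of G can
    be prescribed freely (exists_constt).

    Lower bound (card_noncyclic_Sylows_lt). Let S be a set of at most s
    non-isolated vertices. Map the primes onto S so that every y in S is already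
    the image of a prime with noncyclic Sylow subgroup, and let x have, at each
    prime q, the q-component of the image of q. Then x is not isolated: a
    neighbour is glued in the same way from neighbours of the elements of S.
    But x shares with each y in S some q-component with 'O_q(G) noncyclic, so
    <x, y> is never G, and S does not dominate x.

    Upper bound (exists_total_dominating). If a q-group P is generated by u and
    v, then among the q + 1 elements u, v, v * u, ..., v * u ^+ (q - 1) any two
    generate P (spread_gen): modulo the Frattini subgroup of a noncyclic P they
    represent the q + 1 lines of a plane. When s <= q for all the primes q with
    noncyclic Sylow subgroup, s + 1 of these elements can be chosen in each
    noncyclic 'O_q(G), and a generator in each cyclic one, and then glued into
    s + 1 elements y_j. By generating_exchange, a non-isolated x fails at a
    given q against at most one y_j, so it fails altogether against at most s
    of them, and some y_j is adjacent to x.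

    In the first equivalence, a dominating singleton dominates its own element,
    through a loop, and this element then generates G. *)

Set Implicit Arguments.
Unset Strict Implicit.
Unset Printing Implicit Defensive.

(** * Generating pairs of a finite p-group *)

Section pGroups.

Local Open Scope group_scope.

Variables (gT : finGroupType) (q : nat) (P : {group gT}).
Hypothesis qP : q.-group P.

(** If x lies in maximal subgroups M containing a and N containing b, then
    M :&: N is normal and contains x, so the quotient of P by it is generated by
    the image of z. In this cyclic group the images of M and N have the same
    index q, hence are equal, and M = N contains both a and b. *)
Lemma generating_exchange x z a b :
    <<[set x; z]>> = P -> <<[set a; b]>> = P ->
  <<[set x; a]>> = P \/ <<[set x; b]>> = P.
Proof.
move=> genxz genab.
have [Px Pz] : x \in P /\ z \in P by rewrite -genxz !mem_gen ?set21 ?set22.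
have [Pa Pb] : a \in P /\ b \in P by rewrite -genab !mem_gen ?set21 ?set22.
have pair_sub c d (H : {group gT}) :
    c \in H -> d \in H -> <<[set c; d]>> \subset H.
  by move=> Hc Hd; rewrite gen_subG subUset !sub1set Hc.
have [-> | [M maxM xaM]] := maximal_exists (pair_sub _ _ _ Px Pa); first by left.
have [-> | [N maxN xbN]] := maximal_exists (pair_sub _ _ _ Px Pb); first by right.
have [Mx Ma] : x \in M /\ a \in M by rewrite !(subsetP xaM) ?mem_gen ?set21 ?set22.
have [Nx Nb] : x \in N /\ b \in N by rewrite !(subsetP xbN) ?mem_gen ?set21 ?set22.
have [nsMP nsNP] := (p_maximal_normal qP maxM, p_maximal_normal qP maxN).
pose D := (M :&: N)%G.
have nsDP : D <| P by apply: normalI.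
have nDP := normal_norm nsDP.
have cycPD : cyclic (P / D).
  have PDE : P / D \subset <[coset D z]>.
    rewrite -{1}genxz quotient_gen ?(subset_trans _ nDP) // ?subUset ?sub1set ?Px //.
    rewrite gen_subG quotientU subUset !quotient_set1 ?(subsetP nDP) // !sub1set cycle_id.
    by rewrite coset_id ?group1 // inE Mx.
  exact: cyclicS PDE (cycle_cyclic _).
have sMP := normal_sub nsMP; have sNP := normal_sub nsNP.
have eqMN : M / D = N / D.
  apply/eqP; rewrite (eq_subG_cyclic cycPD) ?quotientS //; apply/eqP.
  rewrite !card_quotient ?(subset_trans _ nDP) // -!divgS ?subsetIl ?subsetIr //.
  congr (_ %/ _)%N; apply/eqP; rewrite -(eqn_pmul2r (indexg_gt0 P M)) Lagrange //.
  by rewrite (p_maximal_index qP maxM) -(p_maximal_index qP maxN) Lagrange.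
have defMN : M :=: N.
  by apply: quotient_inj eqMN; rewrite /normal ?subsetIl ?subsetIr (subset_trans _ nDP).
have /andP[_ /negP[]] := maxgroupp maxM.
by rewrite -genab pair_sub // defMN.
Qed.

(** In additive notation, when u and v form a basis of a plane over the field
    with q elements, the indices j <= q give one vector on each line. *)
Definition spread (u v : gT) (j : nat) : gT :=
  if j is i.+1 then v * u ^+ i else u.

Lemma spread_in u v j : u \in P -> v \in P -> spread u v j \in P.
Proof. by case: j => //= j Pu Pv; rewrite groupM ?groupX. Qed.

(** The quotient of two terms v * u ^+ i is a power of u whose exponent lies
    strictly between 0 and q, so it generates <[u]>. *)
Lemma spread_gen u v j k :
    prime q -> <<[set u; v]>> = P -> j < k <= q ->
  <<[set spread u v j; spread u v k]>> = P.
Proof.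
move=> q_pr genuv /andP[lt_jk le_kq].
have [Pu Pv] : u \in P /\ v \in P by rewrite -genuv !mem_gen ?set21 ?set22.
set H := <<_>>.
have [Hj Hk] : spread u v j \in H /\ spread u v k \in H.
  by rewrite !mem_gen ?set21 ?set22.
apply/eqP; rewrite eqEsubset; apply/andP; split.
  by rewrite gen_subG subUset !sub1set !spread_in.
have Hu : u \in H.
  case: j k lt_jk le_kq @H Hj Hk => [|j] [|k] //= lt_jk lt_kq Hj Hk //.
  rewrite -cycle_subG; set d := (k - j)%N.
  have genud : generator <[u]> (u ^+ d).
    rewrite generator_coprime.
    have [n ->] := p_natP (mem_p_elt qP Pu).
    apply: coprimeXl; rewrite prime_coprime // gtnNdvd ?subn_gt0 //.
    exact: leq_ltn_trans (leq_subr _ _) lt_kq.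
  rewrite (eqP genud) cycle_subG.
  have -> : u ^+ d = (v * u ^+ j)^-1 * (v * u ^+ k).
    by rewrite invMg -mulgA mulKg -(@subnKC j k (ltnW lt_jk)) expgD mulKg.
  by rewrite groupM ?groupV.
have Hv : v \in H.
  by case: (k) lt_jk Hk => // i _ /=; rewrite groupMr ?groupX.
by rewrite -genuv gen_subG subUset !sub1set Hu.
Qed.

End pGroups.

(** * Reduction to the Sylow subgroups of a nilpotent group *)

Section Nilpotent.

Local Open Scope group_scope.

Variables (gT : finGroupType) (G : {group gT}).
Hypothesis nilG : nilpotent G.

Lemma constt_mem_pcore (pi : nat_pred) x : x \in G -> x.`_pi \in 'O_pi(G).
Proof.
move=> Gx; rewrite (mem_normal_Hall (nilpotent_pcore_Hall pi nilG)) ?pcore_normal //.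
  exact: p_elt_constt.
exact: groupX.
Qed.

(** The Chinese remainder principle for a nilpotent group, by induction on the
    list of primes: the components at p and at p^' commute, so correcting the
    p-component leaves the components at the other primes unchanged. *)
Lemma exists_constt (f : nat -> gT) :
    (forall q, f q \in G) ->
  exists2 x, x \in G & {in primes #|G|, forall q : nat, x.`_q = (f q).`_q}.
Proof.
move=> Gf; elim: (primes _) => [|p r [x Gx IHx]]; first by exists 1.
have [_ _ /centsP cOO _] := dprodP (nilpotent_pcoreC p nilG).
have cpp' : commute (f p).`_p x.`_p^' by apply/commute_sym/cOO; apply: constt_mem_pcore.
exists ((f p).`_p * x.`_p^'); first by rewrite groupM ?groupX.
move=> q; rewrite inE consttM //; have [-> _ | neq_qp /= rq] := eqVneq q p.
  by rewrite constt_p_elt ?p_elt_constt // (constt1P (p_elt_constt p^' x)) mulg1.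
have q'fp : q^'.-elt (f p).`_p.
  apply: sub_p_elt (p_elt_constt _ _) => i.
  by rewrite !inE => /eqP->; rewrite eq_sym.
rewrite (constt1P q'fp) mul1g sub_in_constt ?IHx // => i _.
by rewrite !inE => /eqP->.
Qed.

(** Forwards, the subgroup K generated by the q-components satisfies
    G = K * 'O_q^'(G), which forces K = 'O_q(G) because 'O_q(G) and 'O_q^'(G)
    meet trivially. Backwards, <<[set x; y]>> contains every Sylow subgroup. *)
Lemma gen_adj_local x y : x \in G -> y \in G ->
  gen_adj G x y =
    all (fun q : nat => <<[set x.`_q; y.`_q]>> == 'O_q(G)) (primes #|G|).
Proof.
move=> Gx Gy; apply/eqP/allP => [defG q _ | defO].
  have [_ defGq _ tiO] := dprodP (nilpotent_pcoreC q nilG).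
  set K := <<_>>.
  have sKO : K \subset 'O_q(G).
    by rewrite gen_subG subUset !sub1set !constt_mem_pcore.
  have sGK : G \subset K * 'O_q^'(G).
    have nOK : K \subset 'N('O_q^'(G)).
      by rewrite (subset_trans sKO) ?(subset_trans (pcore_sub _ _)) ?gFnorm.
    rewrite -norm_joinEl // -{1}defG gen_subG.
    have xK z : z \in G -> z.`_q \in K -> z \in K <*> 'O_q^'(G).
      move=> Gz Kz; rewrite -(consttC q z) groupM //.
        exact: subsetP (joing_subl _ _) _ Kz.
      exact: subsetP (joing_subr _ _) _ (constt_mem_pcore _ Gz).
    by rewrite subUset !sub1set !xK ?mem_gen ?set21 ?set22.
  rewrite eqEsubset sKO /=; apply/subsetP=> z Oz.
  have /mulsgP[k w Kk Ow defz] := subsetP sGK z (subsetP (pcore_sub _ _) z Oz).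
  suffices /set1P w1: w \in [1 gT] by rewrite defz w1 mulg1.
  rewrite -tiO inE Ow andbT -(mulKg k w) -defz groupM ?groupV //.
  exact: subsetP sKO _ Kk.
have sHG : <<[set x; y]>> \subset G by rewrite gen_subG subUset !sub1set Gx.
apply/eqP; rewrite eqEcard sHG dvdn_leq ?cardG_gt0 //.
apply/dvdn_partP => // q piGq.
have sOH : 'O_q(G) \subset <<[set x; y]>>.
  rewrite -(eqP (defO q piGq)) gen_subG subUset !sub1set !groupX //.
    by rewrite mem_gen ?set22.
  by rewrite mem_gen ?set21.
by rewrite -(card_Hall (nilpotent_pcore_Hall q nilG)) (cardSg sOH).
Qed.

Lemma gen_adj_localP x y : x \in G -> y \in G ->
  reflect {in primes #|G|, forall q : nat, <<[set x.`_q; y.`_q]>> = 'O_q(G)}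
          (gen_adj G x y).
Proof.
by move=> Gx Gy; rewrite gen_adj_local //; apply: (iffP allP) => H q /H/eqP.
Qed.

Lemma noncyclic_SylowsP (P : {group gT}) :
  reflect (exists2 q : nat, q \in primes #|G| & P = 'O_q(G)%G /\ ~~ cyclic P)
          (P \in noncyclic_Sylows G).
Proof.
rewrite inE; apply: (iffP andP).
  case=> /SylowP[q q_pr sylP] ncP.
  have defP := nilpotent_Hall_pcore nilG sylP.
  exists q; last by split=> //; apply: val_inj.
  rewrite mem_primes q_pr cardG_gt0 /=; apply: dvdn_trans (cardSg (pHall_sub sylP)).
  have ntP: P :!=: 1 by apply: contraNneq ncP => ->; apply: cyclic1.
  by have [] := pgroup_pdiv (pHall_pgroup sylP) ntP.
case=> q piGq [-> ncP]; split=> //.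
apply/SylowP; exists q; last exact: nilpotent_pcore_Hall.
by move: piGq; rewrite mem_primes => /and3P[].
Qed.

(** * The lower bound *)

Lemma DeltaP x :
  reflect (exists2 y, y \in G & x \in G /\ gen_adj G x y) (x \in Delta_vertices G).
Proof.
rewrite inE; apply: (iffP andP) => [[Gx /exists_inP[y Gy xy]] | [y Gy [Gx xy]]].
  by exists y.
by split=> //; apply/exists_inP; exists y.
Qed.

Lemma Delta_vertices_neq0 : two_generated G -> Delta_vertices G != set0.
Proof.
case=> u [v defG]; apply/set0Pn; exists u; apply/DeltaP; exists v.
  by rewrite defG mem_gen ?set22.
by split; [rewrite defG mem_gen ?set21 | rewrite /gen_adj /= -defG].
Qed.

Lemma total_dominating_card_gt0 S : two_generated G ->
  total_dominating (gen_adj G) (Delta_vertices G) S -> 0 < #|S|.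
Proof.
move=> /Delta_vertices_neq0/set0Pn[x Vx] /andP[_ /forall_inP/(_ x Vx)].
by case/exists_inP=> y Sy _; apply/card_gt0P; exists y.
Qed.

(** A set S too small is defeated by an x which agrees with each of its elements
    at some noncyclic Sylow subgroup. *)
Lemma card_noncyclic_Sylows_lt S : two_generated G ->
    total_dominating (gen_adj G) (Delta_vertices G) S ->
  #|noncyclic_Sylows G| < #|S|.
Proof.
move=> gen2G domS; have /card_gt0P[y0 Sy0] := total_dominating_card_gt0 gen2G domS.
have /andP[sSV /forall_inP domSP] := domS.
rewrite ltnNge; apply/negP => leSN.
(* The i-th noncyclic Sylow subgroup is sent to the i-th element of S; any
   other prime, and any surplus Sylow subgroup, gets an element of S too. *)
pose f (q : nat) := nth y0 (enum S) (index 'O_q(G)%G (enum (noncyclic_Sylows G))).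
have Sf q : f q \in S.
  rewrite /f; case: (ltnP (index 'O_q(G)%G (enum (noncyclic_Sylows G))) (size (enum S))).
    by move/(mem_nth y0); rewrite mem_enum.
  by move=> le_Sk; rewrite nth_default.
have f_onto y : y \in S ->
    exists2 q : nat, q \in primes #|G| & ~~ cyclic 'O_q(G) /\ f q = y.
  move=> Sy; set k := index y (enum S); set N := enum (noncyclic_Sylows G).
  have lt_kN : k < size N.
    by rewrite -cardE (leq_trans _ leSN) // cardE index_mem mem_enum.
  have /noncyclic_SylowsP[q piGq [defP ncP]] : nth 1%G N k \in noncyclic_Sylows G.
    by rewrite -mem_enum mem_nth.
  exists q => //; rewrite defP in ncP; split=> //.
  by rewrite /f -defP index_uniq ?enum_uniq // nth_index // mem_enum.
(* A neighbour of f q; the default value is never taken. *)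
pose g q := odflt 1 [pick z in G | gen_adj G (f q) z].
have gP q : [/\ f q \in G, g q \in G & gen_adj G (f q) (g q)].
  have /DeltaP[z Gz [Gf fz]] := subsetP sSV _ (Sf q).
  by rewrite /g; case: pickP => [w /andP[] | /(_ z)] //; rewrite Gz fz.
have [|x Gx xE] := @exists_constt f; first by move=> q; have [] := gP q.
have [|z Gz zE] := @exists_constt g; first by move=> q; have [] := gP q.
have /domSP/exists_inP[y Sy xy] : x \in Delta_vertices G.
  apply/DeltaP; exists z => //; split=> //; apply/gen_adj_localP => // q piGq.
  rewrite xE // zE //; have [Gf Gg fg] := gP q.
  exact: (gen_adj_localP Gf Gg fg).
have [q piGq [/negP ncO fq]] := f_onto y Sy.
have Gy : y \in G by have [] := gP q; rewrite fq.
have := gen_adj_localP Gx Gy xy q piGq.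
by rewrite xE // fq setUid => defO; apply: ncO; rewrite -defO cycle_cyclic.
Qed.

(** * The upper bound *)

Section Generators.

Variables u v : gT.
Hypothesis defG : G :=: <<[set u; v]>>.

Let Gu : u \in G. Proof. by rewrite defG mem_gen ?set21. Qed.
Let Gv : v \in G. Proof. by rewrite defG mem_gen ?set22. Qed.

(** The q-components of the dominating set. When 'O_q(G) is cyclic, taking a
    generator ensures that no vertex fails at q. *)
Definition local_spread (q j : nat) : gT :=
  if [pick w in 'O_q(G) | 'O_q(G) == <[w]>] is Some w then w
  else spread u.`_q v.`_q j.

Lemma local_spread_mem (q j : nat) : local_spread q j \in 'O_q(G).
Proof.
rewrite /local_spread; case: pickP => [w /andP[] // | _].
by apply: spread_in; apply: constt_mem_pcore.
Qed.

Lemma local_spread_gen_cyclic (q : nat) x j :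
  x \in G -> cyclic 'O_q(G) -> <<[set x.`_q; local_spread q j]>> = 'O_q(G).
Proof.
move=> Gx /cyclicP[c defO]; have Ox := constt_mem_pcore q Gx.
rewrite /local_spread; case: pickP => [w /andP[Ow /eqP defw] | /(_ c)]; last first.
  by rewrite defO cycle_id eqxx.
apply/eqP; rewrite eqEsubset gen_subG subUset !sub1set Ox Ow {1}defw.
by rewrite cycle_subG mem_gen ?set22.
Qed.

Lemma local_spread_gen_noncyclic (q j k : nat) :
    q \in primes #|G| -> ~~ cyclic 'O_q(G) -> j <= q -> k <= q -> j != k ->
  <<[set local_spread q j; local_spread q k]>> = 'O_q(G).
Proof.
move=> piGq ncO; wlog lt_jk: j k / j < k => [IH | le_jq le_kq _].
  by case: (ltngtP j k) => // lt le_j le_k _; last rewrite setUC; apply: IH;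
    rewrite ?ltn_eqF ?gtn_eqF.
rewrite /local_spread; case: pickP => [w /andP[_ /eqP defw] | _].
  by rewrite defw cycle_cyclic in ncO.
have q_pr : prime q by move: piGq; rewrite mem_primes => /and3P[].
apply: (@spread_gen _ q) => //; rewrite ?lt_jk ?pcore_pgroup //.
by apply: gen_adj_localP => //; rewrite /gen_adj /= defG.
Qed.

End Generators.

(** The pigeonhole argument: if x were adjacent to none of s + 1 glued elements,
    two of them would fail against x at the same prime. *)
Lemma exists_total_dominating :
    two_generated G -> 0 < #|noncyclic_Sylows G| ->
    {in primes #|G|, forall q : nat, ~~ cyclic 'O_q(G) -> #|noncyclic_Sylows G| <= q} ->
  exists2 S, total_dominating (gen_adj G) (Delta_vertices G) S
           & #|S| <= #|noncyclic_Sylows G|.+1.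
Proof.
case=> u [v defG]; set s := #|_| => s_gt0 le_sq.
have /fin_all_exists[y yP] (j : 'I_s.+1) :
    exists y, y \in G /\ {in primes #|G|, forall q : nat, y.`_q = local_spread u v q j}.
  have [|y Gy yE] := @exists_constt (fun q => local_spread u v q j).
    by move=> q; apply: subsetP (pcore_sub _ _) _ (local_spread_mem defG q j).
  exists y; split=> // q piGq; rewrite yE // constt_p_elt //.
  exact: mem_p_elt (pcore_pgroup q G) (local_spread_mem defG q j).
have yG j : y j \in G by have [] := yP j.
have yE j q : q \in primes #|G| -> (y j).`_q = local_spread u v q j.
  by have [_] := yP j; apply.
have y_pair (q : nat) (j k : 'I_s.+1) :
    q \in primes #|G| -> ~~ cyclic 'O_q(G) -> j != k ->
  <<[set (y j).`_q; (y k).`_q]>> = 'O_q(G).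
  move=> piGq ncO neq_jk; rewrite !yE //.
  by apply: local_spread_gen_noncyclic => //; rewrite (leq_trans _ (le_sq q _ _)) // -ltnS.
have y_cyc (q : nat) x j : x \in G -> q \in primes #|G| -> cyclic 'O_q(G) ->
  <<[set x.`_q; (y j).`_q]>> = 'O_q(G).
  by move=> Gx piGq cO; rewrite yE //; apply: local_spread_gen_cyclic.
exists [set y j | j : 'I_s.+1]; last by rewrite -[s.+1 in leqRHS]card_ord leq_imset_card.
apply/andP; split.
  apply/subsetP=> _ /imsetP[j _ ->]; apply/DeltaP.
  have [k neq_jk] : exists k, j != k.
    have [-> | ] := eqVneq j ord0; last by exists ord0.
    by exists ord_max; rewrite -val_eqE /= eq_sym -lt0n.
  exists (y k) => //; split=> //; apply/gen_adj_localP => // q piGq.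
  by have [/y_cyc-> | /y_pair->] := boolP (cyclic 'O_q(G)).
apply/forall_inP=> x /DeltaP[z Gz [Gx xz]].
apply: contraT; rewrite negb_exists => /forallP bad.
have /fin_all_exists[h hP] (j : 'I_s.+1) : exists q : nat,
    [/\ q \in primes #|G|, ~~ cyclic 'O_q(G)
      & <<[set x.`_q; (y j).`_q]>> <> 'O_q(G)].
  have := bad (y j); rewrite imset_f //= gen_adj_local // => /allPn[q piGq /eqP nq].
  exists q; split=> //; apply: contra_notN nq; exact: y_cyc.
(* Two distinct failures at one prime contradict the exchange property, as the
   components of y j and y k generate 'O_q(G). *)
have inj_h : injective (fun j => 'O_(h j)(G)%G).
  move=> j k eqO; apply/eqP; apply: contraT => neq_jk.
  have [piGj ncj badj] := hP j; have [piGk nck badk] := hP k.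
  have eq_h : h j = h k.
    have ntO : 'O_(h j)(G) != 1 by apply: contraNneq ncj => ->; apply: cyclic1.
    have [hj_pr dv_hj _] := pgroup_pdiv (pcore_pgroup (h j) G) ntO.
    apply/eqP/(pgroupP (pcore_pgroup (h k) G)) => //.
    by have <- : 'O_(h j)(G)%G = 'O_(h k)(G)%G by [].
  rewrite -eq_h in badk.
  have qO := pcore_pgroup (h j) G.
  have genxz := gen_adj_localP Gx Gz xz _ piGj.
  by case: (generating_exchange qO genxz (y_pair _ _ _ piGj ncj neq_jk)).
have := subset_leq_card (_ : [set 'O_(h j)(G)%G | j : 'I_s.+1] \subset noncyclic_Sylows G).
rewrite card_imset // card_ord ltnn => -> //.
apply/subsetP=> _ /imsetP[j _ ->]; apply/noncyclic_SylowsP.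
by have [piGj ncj _] := hP j; exists (h j).
Qed.

End Nilpotent.

(** * Total domination number *)

Theorem theorem3 (gT : finGroupType) (G : {group gT})
    (nilG : nilpotent G) (gen2G : two_generated G) :
  (gamma_t_Delta G = 1 <-> cyclic G)
  /\ (forall s p : nat,
        1 <= s ->
        #|noncyclic_Sylows G| = s ->
        noncyclic_Sylow_prime G p ->
        (forall q : nat, noncyclic_Sylow_prime G q -> p <= q) ->
        s + 1 <= gamma_t_Delta G
        /\ (s <= p -> gamma_t_Delta G = s + 1)).
Proof.
have [[S0 domS0 cardS0] minS] := total_domination_numberP (@Delta_nonisolated _ G).
rewrite -/(gamma_t_Delta G) in cardS0 minS.
split=> [|s p s_gt0 cardN _ p_min].
  split=> [g1 | /cyclicP[g defG]].
    have /eqP/cards1P[y defS] : #|S0| = 1 by rewrite -cardS0.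
    have /andP[sSV /forall_inP domS0P] := domS0.
    have Sy : y \in S0 by rewrite defS set11.
    have /exists_inP[z] := domS0P y (subsetP sSV y Sy).
    rewrite defS => /set1P-> /eqP <-.
    by rewrite setUid; apply: cycle_cyclic.
  have gG x : x \in G -> gen_adj G x g.
    move=> Gx; rewrite /gen_adj /= eqEsubset gen_subG subUset !sub1set Gx.
    by rewrite {1 2}defG cycle_id cycle_subG mem_gen ?set22.
  have Gg : g \in G by rewrite defG cycle_id.
  have domg : total_dominating (gen_adj G) (Delta_vertices G) [set g].
    rewrite /total_dominating sub1set; apply/andP; split.
      by apply/DeltaP; exists g => //; split=> //; apply: gG.
    apply/forall_inP=> x /DeltaP[_ _ [Gx _]].
    by apply/exists_inP; exists g; rewrite ?set11 ?gG.
  apply/eqP; rewrite eqn_leq -{1}(cards1 g) minS //= cardS0.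
  exact: total_dominating_card_gt0 domS0.
have lower : s + 1 <= gamma_t_Delta G.
  by rewrite addn1 cardS0 -cardN card_noncyclic_Sylows_lt.
split=> // le_sp; apply/eqP; rewrite eqn_leq lower andbT.
have [| |S domS leS] := exists_total_dominating nilG gen2G.
- by rewrite cardN.
- move=> q piGq ncO; rewrite cardN (leq_trans le_sp) //; apply: p_min.
  split; first by move: piGq; rewrite mem_primes => /and3P[].
  by exists 'O_q(G)%G => //; apply: nilpotent_pcore_Hall.
by rewrite (leq_trans (minS S domS)) // addn1 -cardN.
Qed.
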